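(* For $0\le\lambda\le 1$ and all integers $k\ge 2$, $n\ge 1$, $$G_{k,n}(\lambda)=G_{k-1,n}(\lambda)+\lambda\, G_{k,n-1}\!\left(\frac{n-1}{n}\lambda\right),$$ with $G_{1,n}(\lambda)\equiv 1$ for $n\ge 1$ and the convention $G_{k,0}(\lambda):=1$.
   Context: $\Delta^{k-1}=\{p\in\mathbb{R}^k: p_i\ge 0,\ \sum_{i=1}^k p_i=1\}$. For integers $k\ge 1$, $n\ge 1$, $p\in\Delta^{k-1}$, $\lambda\in[0,1]$, $$G_{k,n}(\lambda,p):=\sum_{X_1,\dots,X_k}\binom{n}{X_1,\dots,X_k}\prod_{i=1}^k\left[\lambda X_i/n+(1-\lambda)p_i\right]^{X_i},$$ where the sum is over non-negative integers $X_1,\dots,X_k$ with $X_1+\dots+X_k=n$, and $0^0=1$. This value does not depend on $p\in\Delta^{k-1}$; the common value is denoted $G_{k,n}(\lambda)$. *)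

(* Defs.v *)
From mathcomp Require Import all_boot all_order all_algebra.

Set Implicit Arguments.
Unset Strict Implicit.
Unset Printing Implicit Defensive.

Import Order.TTheory GRing.Theory Num.Theory.
Local Open Scope ring_scope.

Definition in_simplex (R : realFieldType) (k : nat) (p : 'I_k -> R) : Prop :=
  (forall i, 0 <= p i) /\ \sum_(i < k) p i = 1.

(* The quotient is exact when \sum_i X i = n, the only case in which it is
   used. *)
Definition multinomial (k n : nat) (X : 'I_k -> nat) : nat :=
  (n`! %/ \prod_(i < k) (X i)`!)%N.

(* G_{k,n}(lam, p).  The values X_i range over {0, ..., n}, which loses nothing
   since they are natural numbers summing to n; 0 ^+ 0 = 1 by expr0.
   The case n = 0 is the convention G_{k,0} := 1.
   The common value G_{k,n}(lam) is rendered by quantifying over all p in the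
   simplex, separately for each occurrence. *)
Definition G (R : realFieldType) (k n : nat) (lam : R) (p : 'I_k -> R) : R :=
  if n == 0%N then 1 else
  \sum_(X : {ffun 'I_k -> 'I_n.+1} | (\sum_(i < k) X i)%N == n)
    (multinomial n (fun i : 'I_k => X i))%:R *
    \prod_(i < k) (lam * ((X i)%:R / n%:R) + (1 - lam) * p i) ^+ X i.

(* Main.v *)
Require Import Defs.
From mathcomp Require Import all_boot all_order all_algebra.
From mathcomp Require Import ring.

Import Order.TTheory GRing.Theory Num.Theory.
Local Open Scope ring_scope.

(** Write [a = lam / n] and
    [P_x(z) = \sum_j (x + j a)^j / j! z^j].
    Distributing the factorials in the multinomial coefficient shows that
    [G n lam p] is [n!] times the coefficient of [z^n] in the product of the
    series [P_{(1 - lam) p_i}].  Two identities between these series suffice.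

    - [P_x P_y = P_{x + y} P_0] ([abel_seriesM]), a form of Abel's binomial
      identity.  The coefficient of [z^n] in [P_t P_{s - t}] is a polynomial
      in [t], and its derivative is, up to a shift of [t], a difference of two
      copies of the same polynomial for [n - 1] and [s + a]; by induction
      on [n] it vanishes.
    - [P_0 = 1 + a z P_a] ([abel_series0]), by comparison of coefficients.

    The first one turns a product of [k] series into [P_s P_0^(k-1)], where
    [s] is the sum of the parameters; here [s = 1 - lam] whatever [p] is.
    Combined with the second one it gives
    [P_s P_0^(m+1) = P_s P_0^m + a z P_{s + a} P_0^(m+1)]
    ([abel_series_rec]).  Its coefficient of [z^n], multiplied by [n!], is the
    claimed recurrence: [n! a = lam (n-1)!], and [lam' = (n-1) a] is the
    parameter in rank [n - 1] that has the same slope [a] and satisfies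
    [1 - lam' = (1 - lam) + a].

    The series are truncated to polynomials, and the identities are
    congruences modulo a power of the variable. *)

(** * Congruence modulo a power of the variable *)

Definition eq_upto {R : nzRingType} (N : nat) (p q : {poly R}) : Prop :=
  forall i, (i < N)%N -> p`_i = q`_i.

Lemma eq_upto_refl {R : nzRingType} {N : nat} {p : {poly R}} : eq_upto N p p.
Proof. by []. Qed.

Lemma eq_upto_trans {R : nzRingType} {N : nat} {q p r : {poly R}} :
  eq_upto N p q -> eq_upto N q r -> eq_upto N p r.
Proof. by move=> pq qr i iN; rewrite pq // qr. Qed.

Lemma eq_uptoD {R : nzRingType} {N : nat} {p p' q q' : {poly R}} :
  eq_upto N p p' -> eq_upto N q q' -> eq_upto N (p + q) (p' + q').
Proof. by move=> pp' qq' i iN; rewrite !coefD pp' ?qq'. Qed.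

Lemma eq_uptoM {R : nzRingType} {N : nat} {p p' q q' : {poly R}} :
  eq_upto N p p' -> eq_upto N q q' -> eq_upto N (p * q) (p' * q').
Proof.
move=> pp' qq' i iN; rewrite !coefM; apply: eq_bigr => j _.
have ji : (j <= i)%N by rewrite -ltnS.
by rewrite pp' ?qq' //; apply: leq_ltn_trans iN; rewrite ?leq_subr.
Qed.

(** * Abel coefficients *)

(** Abel's polynomials [(X + j a)^j / j!], normalised so that differentiation
    lowers the index and shifts the variable by [a]. *)
Definition abel_poly {R : numFieldType} (a : R) (j : nat) : {poly R} :=
  j`!%:R^-1 *: ('X + (j%:R * a)%:P) ^+ j.

(** The coefficient of [z^n] in the product of the series with parameters
    [t] and [s - t], as a polynomial in [t]: with the sum of the parameters
    fixed, its independence of [t] can be tested by differentiation. *)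
Definition abel_conv {R : numFieldType} (a s : R) (n : nat) : {poly R} :=
  \sum_(j < n.+1) abel_poly a j * (abel_poly a (n - j) \Po (s%:P - 'X)).

Lemma fact_neq0 {R : numFieldType} (n : nat) : n`!%:R != 0 :> R.
Proof. by rewrite pnatr_eq0 -lt0n fact_gt0. Qed.

Lemma horner_abel_poly {R : numFieldType} (a x : R) (j : nat) :
  (abel_poly a j).[x] = j`!%:R^-1 * (x + j%:R * a) ^+ j.
Proof. by rewrite /abel_poly hornerZ horner_exp !hornerE. Qed.

Lemma abel_poly0 {R : numFieldType} (a : R) : abel_poly a 0 = 1.
Proof. by rewrite /abel_poly expr0 fact0 invr1 scale1r. Qed.

Lemma deriv_abel_poly {R : numFieldType} (a : R) (j : nat) :
  (abel_poly a j.+1)^`() = abel_poly a j \Po ('X + a%:P).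
Proof.
rewrite /abel_poly derivZ deriv_exp derivD derivX derivC addr0 mul1r.
rewrite comp_polyZ rmorphXn /= comp_polyD comp_polyX comp_polyC.
have -> : 'X + a%:P + (j%:R * a)%:P = 'X + (j.+1%:R * a)%:P :> {poly R}.
  by rewrite -addrA -polyCD -natr1 mulrDl mul1r [a + _]addrC.
rewrite -scaler_nat scalerA; congr (_ *: _).
rewrite factS natrM invfM mulrC mulrA mulfV ?mul1r //.
by rewrite pnatr_eq0.
Qed.

Lemma deriv_eq0 {R : numFieldType} (p : {poly R}) :
  p^`() = 0 -> p = (p`_0)%:P.
Proof.
move=> p'0; apply/polyP => -[|i]; rewrite coefC //=.
have := coef_deriv p i; rewrite p'0 coef0 => /esym/eqP.
by rewrite -mulr_natr mulf_eq0 pnatr_eq0 orbF => /eqP.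
Qed.

(** Differentiating either factor of a summand replaces it by the Abel
    polynomial of lower index shifted by [a].  Both halves of the derivative
    are thus convolutions of order [n] for the sum [s + a]; the one from the
    first factors is evaluated at [X + a]. *)
Lemma deriv_abel_conv {R : numFieldType} (a s : R) (n : nat) :
  (abel_conv a s n.+1)^`() =
  abel_conv a (s + a) n \Po ('X + a%:P) - abel_conv a (s + a) n.
Proof.
rewrite /abel_conv raddf_sum /=.
under eq_bigr => j _ do
  rewrite derivM deriv_comp derivB derivX derivC sub0r mulrN1 mulrN.
rewrite sumrB; congr (_ - _).
  rewrite big_ord_recl abel_poly0 derivC mul0r add0r raddf_sum /=.
  apply: eq_bigr => j _; rewrite /bump add1n subSS deriv_abel_poly comp_polyM.
  congr (_ * _); rewrite -comp_polyA; congr (_ \Po _).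
  rewrite comp_polyB comp_polyX comp_polyC polyCD; ring.
rewrite big_ord_recr /= subnn abel_poly0 derivC comp_poly0 mulr0 addr0.
apply: eq_bigr => j _.
have jn : (j <= n)%N by rewrite -ltnS.
rewrite subSn // deriv_abel_poly -comp_polyA; congr (_ * (_ \Po _)).
rewrite comp_polyD comp_polyX comp_polyC polyCD; ring.
Qed.

(** If the convolutions of order [n] are constant, the shift in
    [deriv_abel_conv] has no effect and the derivative at order [n + 1]
    vanishes. *)
Lemma abel_conv_const {R : numFieldType} (a s : R) (n : nat) :
  abel_conv a s n = ((abel_conv a s n)`_0)%:P.
Proof.
elim: n s => [|n IHn] s; apply: deriv_eq0.
  by rewrite /abel_conv big_ord1 abel_poly0 comp_polyC mul1r derivC.
by rewrite deriv_abel_conv IHn comp_polyC subrr.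
Qed.

(** * Abel series *)

Definition abel_series {R : numFieldType} (N : nat) (a x : R) : {poly R} :=
  \poly_(j < N) (abel_poly a j).[x].

Lemma coef_abel_seriesM {R : numFieldType} (N n : nat) (a x y : R) :
  (n < N)%N ->
  (abel_series N a x * abel_series N a y)`_n =
  (abel_conv a (x + y) n).[x].
Proof.
move=> nN; rewrite coefM /abel_conv horner_sum; apply: eq_bigr => j _.
have jn : (j <= n)%N by rewrite -ltnS.
rewrite !coef_poly (leq_ltn_trans jn nN) (leq_ltn_trans (leq_subr _ _) nN).
by rewrite hornerM horner_comp !hornerE [x + y]addrC addrK.
Qed.

(** Both sides are values of one convolution, for the sum [x + y], at the
    points [x] and [x + y]. *)
Lemma abel_seriesM {R : numFieldType} (N : nat) (a x y : R) :
  eq_upto N (abel_series N a x * abel_series N a y)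
              (abel_series N a (x + y) * abel_series N a 0).
Proof.
move=> n nN; rewrite !coef_abel_seriesM // addr0.
by rewrite abel_conv_const !hornerC.
Qed.

(** Coefficientwise, this is
    [(j a)^j / j! = a (a + (j - 1) a)^(j - 1) / (j - 1)!]. *)
Lemma abel_series0 {R : numFieldType} (N : nat) (a : R) :
  eq_upto N (abel_series N a 0) (1 + a%:P * 'X * abel_series N a a).
Proof.
case=> [|i] iN.
  by rewrite coefD -mulrA coefCM coefXM mulr0 addr0 coef_poly iN abel_poly0
             coefC hornerC.
rewrite coefD coef1 add0r -mulrA coefCM coefXM /= !coef_poly iN (ltnW iN).
rewrite !horner_abel_poly add0r.
have -> : a + i%:R * a = i.+1%:R * a by rewrite -natr1; ring.
rewrite exprS factS natrM; field.
by rewrite fact_neq0 addrC natr1 pnatr_eq0.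
Qed.

Lemma prod_abel_series {R : numFieldType} (N k : nat) (a : R)
    (b : 'I_k.+1 -> R) :
  eq_upto N (\prod_(i < k.+1) abel_series N a (b i))
    (abel_series N a (\sum_(i < k.+1) b i) * abel_series N a 0 ^+ k).
Proof.
elim: k b => [|k IHk] b; first by rewrite !big_ord1 expr0 mulr1.
rewrite big_ord_recr [\sum_(i < k.+2) _]big_ord_recr /=.
apply: eq_upto_trans (eq_uptoM (IHk _) eq_upto_refl) _.
rewrite mulrAC exprS mulrA.
by apply: eq_uptoM; [apply: abel_seriesM | apply: eq_upto_refl].
Qed.

(** Expand one factor [P_0] on the left by [abel_series0], then turn the
    resulting [P_s P_a] into [P_{s + a} P_0]. *)
Lemma abel_series_rec {R : numFieldType} (N m : nat) (a s : R) :
  eq_upto N (abel_series N a s * abel_series N a 0 ^+ m.+1)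
    (abel_series N a s * abel_series N a 0 ^+ m
     + a%:P * 'X * (abel_series N a (s + a) * abel_series N a 0 ^+ m.+1)).
Proof.
set P := abel_series N a.
have -> : P s * P 0 ^+ m.+1 = (P s * P 0 ^+ m) * P 0 by rewrite exprSr mulrA.
apply: eq_upto_trans.
  by apply: eq_uptoM; [apply: eq_upto_refl | apply: abel_series0].
rewrite -/P mulrDr mulr1; apply: eq_uptoD; first exact: eq_upto_refl.
have -> : P s * P 0 ^+ m * (a%:P * 'X * P a)
        = (a%:P * 'X * P 0 ^+ m) * (P s * P a) by ring.
have -> : a%:P * 'X * (P (s + a) * P 0 ^+ m.+1)
        = (a%:P * 'X * P 0 ^+ m) * (P (s + a) * P 0) by rewrite exprS; ring.
by apply: eq_uptoM; [apply: eq_upto_refl | apply: abel_seriesM].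
Qed.

(** * The multinomial sum as a coefficient *)

Lemma coef_prod_poly {R : comNzRingType} (k n : nat) (c : 'I_k -> nat -> R) :
  (\prod_(i < k) \poly_(j < n.+1) c i j)`_n =
  \sum_(X : {ffun 'I_k -> 'I_n.+1} | (\sum_(i < k) X i)%N == n)
    \prod_(i < k) c i (X i).
Proof.
under eq_bigr do rewrite poly_def.
rewrite bigA_distr_bigA coef_sum [RHS]big_mkcond /=.
apply: eq_bigr => X _.
have -> : \prod_i (c i (X i) *: 'X^(X i))
        = (\prod_i c i (X i)) *: 'X^(\sum_i X i)%N :> {poly R}.
  by rewrite scaler_prod -expr_sum.
by rewrite coefZ coefXn eq_sym; case: eqP; rewrite ?mulr1 ?mulr0.
Qed.

Lemma dvdn_prod_fact {k : nat} (X : 'I_k -> nat) :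
  (\prod_(i < k) (X i)`! %| (\sum_(i < k) X i)`!)%N.
Proof.
elim: k X => [|k IHk] X; first by rewrite !big_ord0.
rewrite !big_ord_recr /=; set s := (\sum_(i < k) _)%N.
have <- := bin_fact (leq_addl s (X ord_max)).
by rewrite addnK mulnCA mulnC dvdn_mul ?dvdn_mull // mulnC dvdn_mul.
Qed.

Lemma natr_multinomial {R : numFieldType} (k n : nat) (X : 'I_k -> nat) :
  (\sum_(i < k) X i)%N = n ->
  (multinomial n X)%:R = n`!%:R * \prod_(i < k) (X i)`!%:R^-1 :> R.
Proof.
move=> sX; have dv := dvdn_prod_fact X; rewrite sX in dv.
have nz : \prod_(i < k) (X i)`!%:R != 0 :> R.
  by apply/prodf_neq0 => i _; apply: fact_neq0.
apply: (mulIf nz); rewrite -mulrA -big_split /=.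
rewrite [X in _ = _ * X]big1 ?mulr1; last first.
  by move=> i _; rewrite mulVf ?fact_neq0.
by rewrite -natr_prod -natrM /multinomial divnK.
Qed.

(** The slope [a] is only constrained by [lam = n a], so that the case [n = 0],
    where both sides are [1], is covered for every [a].  The truncation order
    [N] is free, so that [G] at two different ranks can be read off the same
    polynomials. *)
Lemma G_coef {R : realFieldType} (k n N : nat) (a lam : R) (p : 'I_k.+1 -> R) :
  (n < N)%N -> lam = n%:R * a -> in_simplex p ->
  G n lam p =
  n`!%:R * (abel_series N a (1 - lam) * abel_series N a 0 ^+ k)`_n.
Proof.
move=> nN lamE [_ sp].
have -> : 1 - lam = \sum_(i < k.+1) (1 - lam) * p i by rewrite -mulr_sumr sp mulr1.
rewrite -(prod_abel_series N k a (fun i => (1 - lam) * p i)) //.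
(* The sum defining G has exponents at most n, hence truncation at n.+1. *)
have trunc : eq_upto n.+1
    (\prod_(i < k.+1) abel_series N a ((1 - lam) * p i))
    (\prod_(i < k.+1) \poly_(j < n.+1) (abel_poly a j).[(1 - lam) * p i]).
  apply: big_ind2 => [|? ? ? ?|i _]; first exact: eq_upto_refl.
    exact: eq_uptoM.
  by move=> j jn; rewrite !coef_poly jn (leq_trans jn nN).
rewrite trunc // coef_prod_poly /G; case: eqP => [n0|/eqP n0].
  subst n; rewrite (big_pred1 [ffun=> ord0]) => [|X]; last first.
    rewrite big1 => [|i _]; last by rewrite (ord1 (X i)).
    by rewrite eqxx; apply/esym/eqP/ffunP => i; rewrite ffunE ord1.
  by rewrite big1 ?mulr1 // => i _; rewrite ffunE abel_poly0 hornerC.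
rewrite mulr_sumr; apply: eq_bigr => X /eqP sX.
rewrite natr_multinomial // -mulrA -big_split /=; congr (_ * _).
apply: eq_bigr => i _; rewrite horner_abel_poly; congr (_ * _ ^+ _).
rewrite lamE; field.
by rewrite pnatr_eq0.
Qed.

Theorem proposition2 (R : realFieldType) (k n : nat) (lam : R)
    (hk : (2 <= k)%N) (hn : (1 <= n)%N) (hlam : 0 <= lam <= 1) :
  (forall p : 'I_1 -> R, in_simplex p -> G n lam p = 1) /\
  (forall (p : 'I_k -> R) (q : 'I_k.-1 -> R) (r : 'I_k -> R),
     in_simplex p -> in_simplex q -> in_simplex r ->
     G n lam p = G n lam q + lam * G n.-1 (n.-1%:R / n%:R * lam) r).
Proof.
have n0 : n%:R != 0 :> R by rewrite pnatr_eq0 -lt0n.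
have lamE : lam = n%:R * (lam / n%:R) by field.
split=> [p hp|].
  rewrite (G_coef 0 n n.+1 (lam / n%:R)) // expr0 mulr1 coef_poly ltnSn.
  by rewrite horner_abel_poly mulrA mulfV ?fact_neq0 // -lamE subrK mul1r expr1n.
case: k hk => [|[|m]] // _; case: n hn n0 lamE => // n _ n0 lamE p q r hp hq hr.
set a := lam / n.+1%:R in lamE *.
have lamE' : n%:R / n.+1%:R * lam = n%:R * a by rewrite /a mulrAC mulrA.
rewrite (G_coef m.+1 n.+1 n.+2 a lam p) // (G_coef m n.+1 n.+2 a lam q) //.
rewrite (G_coef m.+1 n n.+2 a _ r) //=.
have -> : 1 - n%:R / n.+1%:R * lam = 1 - lam + a.
  by rewrite lamE' [in RHS]lamE -natr1; ring.
rewrite abel_series_rec // coefD -mulrA coefCM coefXM /= mulrDr; congr (_ + _).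
by rewrite [in X in _ = X * _]lamE factS natrM; ring.
Qed.
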